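(* Let $n\ge 1$ and let $\mathbb R^n_+=\{x=(x_1,\dots,x_n)\in\mathbb R^n : x_n>0\}$. Let $w$ be a positive solution of the Dirichlet heat equation $w_t=\Delta w$ on $\mathbb R^n_+\times(0,\infty)$, $w=0$ on $\{x_n=0\}$, with nonnegative initial datum $g\ge 0$; that is, $g:\mathbb R^n_+\to[0,\infty)$ is measurable and $$w(x,t)=\int_{\mathbb R^n_+}K_D(x,y,t)\,g(y)\,dy$$ is finite and strictly positive for all $(x,t)\in\mathbb R^n_+\times(0,\infty)$, where $K_D$ is the Dirichlet heat kernel of $\mathbb R^n_+$. Then for every $x\in\mathbb R^n_+$ and every $t>0$, $$\Delta\log w(x,t)\ \ge\ -\frac{n}{2t}-\frac{1}{x_n^2}.$$ Equivalently, for every $x\in\mathbb R^n_+$ and every $t>0$, $$\frac{\Delta w(x,t)}{w(x,t)}-\frac{|\nabla w(x,t)|^2}{w(x,t)^2}\ \ge\ -\frac{n}{2t}-\frac{1}{x_n^2}.$$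
   Context: Write $x=(x',x_n)$ and $y=(y',y_n)$ with $x',y'\in\mathbb R^{n-1}$ and $x_n,y_n>0$. The Dirichlet heat kernel of the half-space $\mathbb R^n_+$ is, for $x,y\in\mathbb R^n_+$ and $t>0$, $$K_D(x,y,t)=\frac{1}{(4\pi t)^{n/2}}\,e^{-\frac{|x'-y'|^2}{4t}}\left(e^{-\frac{(x_n-y_n)^2}{4t}}-e^{-\frac{(x_n+y_n)^2}{4t}}\right).$$ The operators $\nabla$ and $\Delta$ are the Euclidean gradient and Laplacian in the spatial variable $x$. *)

(* Defs.v *)
From HB Require Import structures.
From mathcomp Require Import all_boot all_order all_algebra.
From mathcomp Require Import all_classical all_reals all_analysis.

Set Implicit Arguments.
Unset Strict Implicit.
Unset Printing Implicit Defensive.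

Import Order.TTheory GRing.Theory Num.Theory.
Import numFieldNormedType.Exports.
Local Open Scope classical_set_scope.
Local Open Scope ring_scope.

(* The dimension is written n.+1 throughout, so that it is at least 1 and the
   last coordinate x_n of x : 'rV[R]_n.+1 is x 0 ord_max. *)

(* MathComp-Analysis has no Lebesgue measure on 'rV[R]_n.+1.  As for its
   one-dimensional completed_lebesgue_measure, we take the outer measure given
   by countable covers by half-open boxes, restricted to its Caratheodory
   sigma-algebra, i.e. to the Lebesgue-measurable sets. *)
Section lebesgue.
Context {R : realType} {n : nat}.
Local Open Scope ereal_scope.

Definition box (c : 'rV[R]_n.+1 * 'rV[R]_n.+1) : set 'rV[R]_n.+1 :=
  [set y | forall i, (c.1 0%R i < y 0%R i <= c.2 0%R i)%R].

(* The truncation at 0 gives volume 0 to every empty box. *)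
Definition box_volume (c : 'rV[R]_n.+1 * 'rV[R]_n.+1) : R :=
  (\prod_(i < n.+1) Num.max 0 (c.2 0 i - c.1 0 i))%R.

Definition box_cover (A : set 'rV[R]_n.+1) :=
  [set c : nat -> 'rV[R]_n.+1 * 'rV[R]_n.+1 | A `<=` \bigcup_k box (c k)].

Definition lebesgue_outer (A : set 'rV[R]_n.+1) : \bar R :=
  ereal_inf [set \sum_(k <oo) (box_volume (c k))%:E | c in box_cover A].

Lemma box_volume_ge0 c : 0 <= (box_volume c)%:E.
Proof. by rewrite lee_fin; apply: prodr_ge0 => i _; rewrite le_max lexx. Qed.

Lemma box_volume0 : box_volume (0%R, 0%R) = 0%R.
Proof.
by rewrite /box_volume (bigD1 ord0)//= mxE subrr maxxx mul0r.
Qed.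

Lemma lebesgue_outer_ge0 A : 0 <= lebesgue_outer A.
Proof.
apply: le_ereal_inf_tmp => x [c _ <-{x}].
by apply: nneseries_ge0 => k _ _; exact: box_volume_ge0.
Qed.

Lemma lebesgue_outer0 : lebesgue_outer set0 = 0.
Proof.
apply/eqP; rewrite eq_le lebesgue_outer_ge0 andbT.
apply: ereal_inf_lbound; exists (fun=> (0%R, 0%R)); first by move=> ? [].
by apply: eseries0 => k _ _; rewrite box_volume0.
Qed.

Lemma le_lebesgue_outer : {homo lebesgue_outer : A B / A `<=` B >-> A <= B}.
Proof.
move=> A B AB; apply/ereal_inf_le_tmp => x [c Bc <-{x}].
by exists c => //; exact: subset_trans AB Bc.
Qed.

Lemma lebesgue_outer_sigma_subadditive : sigma_subadditive lebesgue_outer.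
Proof.
move=> A; have [[i ioo]|] := pselect (exists i, lebesgue_outer (A i) = +oo).
  rewrite (eseries_pinfty _ _ ioo) ?leey// => k _.
  by rewrite -ltNye (lt_le_trans _ (lebesgue_outer_ge0 _)).
rewrite -forallNE => Aoo.
suff add2e (e : {posnum R}) : lebesgue_outer (\bigcup_k A k) <=
    \sum_(i <oo) lebesgue_outer (A i) + e%:num%:E.
  by apply/lee_addgt0Pr => _/posnumP[].
rewrite (le_trans _ (epsilon_trick _ _ _))//; last first.
  by move=> k; exact: lebesgue_outer_ge0.
pose P k c := box_cover (A k) c /\
  \sum_(j <oo) (box_volume (c j))%:E <=
  lebesgue_outer (A k) + (e%:num / (2 ^ k.+1)%:R)%:E.
have [G PG] : {G & forall k, P k (G k)}.
  apply: (@choice _ _ P) => k; rewrite /P /lebesgue_outer.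
  set S := (X in ereal_inf X); move infS : (ereal_inf S) => iS.
  case: iS infS => [r Sr|Soo|Soo].
  - have en1 : (0 < e%:num / (2 ^ k.+1)%:R)%R by [].
    have /(lb_ereal_inf_adherent en1) : ereal_inf S \is a fin_num by rewrite Sr.
    move=> [x [B AB muBx] xS].
    by exists B; split => //; rewrite muBx -Sr; exact/ltW.
  - by have := Aoo k; rewrite /lebesgue_outer Soo.
  - by have := lebesgue_outer_ge0 (A k); rewrite /lebesgue_outer Soo.
pose v (ij : nat * nat) := (box_volume (G ij.1 ij.2))%:E.
have v_ge0 x : 0 <= v x by exact: box_volume_ge0.
apply: (@le_trans _ _ (\esum_(i in setT) v i)).
  apply: ereal_inf_lbound => /=.
  have /card_esym/ppcard_eqP[f] := card_nat2.
  exists (fun k => G (f k).1 (f k).2).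
    move=> t [i _] /(PG i).1 [j _ Bijt]; exists (f^-1%FUN (i, j)) => //=.
    by rewrite invK ?inE.
  rewrite -(esum_pred_image v f xpredT) ?[fun=> _]set_true//.
  by rewrite image_eq.
rewrite (_ : esum _ _ = \sum_(i <oo) \sum_(j <oo) v (i, j)); last first.
  pose J : nat -> set (nat * nat) := fun i => [set (i, j) | j in setT].
  rewrite (_ : setT = \bigcup_k J k); last first.
    by rewrite predeqE => -[a b]; split => // _; exists a => //; exists b.
  rewrite esum_bigcupT//=; last first.
    apply/trivIsetP => i j _ _ ij.
    rewrite predeqE => -[k m] /=; split => //= -[] [_] _ [<-{k} _].
    by move=> [m' _] [] /esym/eqP; rewrite (negbTE ij).
  rewrite -(image_id [set: nat]) -fun_true esum_pred_image//; last first.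
    by move=> k _; exact: esum_ge0.
  apply: eq_eseriesr => /= j _.
  rewrite -(esum_pred_image v (pair j) predT)//=; last first.
    by move=> ? ? _ _; exact: (@can_inj _ _ _ snd).
  by congr esum; rewrite predeqE => -[a b]; split; move=> [i _ <-]; exists i.
apply: lee_lim.
- by apply: is_cvg_nneseries => k *; apply: nneseries_ge0.
- apply: is_cvg_nneseries => k *.
  by apply: adde_ge0 => //; exact: lebesgue_outer_ge0.
- by near=> k; apply: lee_sum => i _; exact: (PG i).2.
Unshelve. all: by end_near. Qed.

HB.instance Definition _ := isOuterMeasure.Build R 'rV[R]_n.+1 lebesgue_outer
  lebesgue_outer0 lebesgue_outer_ge0 le_lebesgue_outer
  lebesgue_outer_sigma_subadditive.

End lebesgue.

(* 'rV[R]_n.+1 equipped with the sigma-algebra of Lebesgue-measurable sets *)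
Notation leb_rV R n := (caratheodory_type (@lebesgue_outer R n)).

Definition lebesgue_rV {R : realType} {n : nat} : set (leb_rV R n) -> \bar R :=
  @lebesgue_outer R n.

HB.instance Definition _ (R : realType) (n : nat) :=
  isMeasure.Build _ (leb_rV R n) R (@lebesgue_rV R n)
    (@caratheodory_measure0 R _ (@lebesgue_outer R n))
    (@caratheodory_measure_ge0 R _ (@lebesgue_outer R n))
    (@caratheodory_measure_sigma_additive R _ (@lebesgue_outer R n)).

Section calculus.
Context {R : realType} {n : nat}.
Implicit Types (f : 'rV[R]_n -> R) (x v : 'rV[R]_n).

Definition partial (i : 'I_n) f x : R := 'D_(delta_mx 0 i) f x.

Definition grad f x : 'rV[R]_n := \row_i partial i f x.

(* |v|^2 for the Euclidean norm; the library's `|v| on 'rV is the sup norm. *)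
Definition sqnorm v : R := \sum_(i < n) v 0 i ^+ 2.

Definition laplacian f x : R := \sum_(i < n) partial i (partial i f) x.

(* 'D_v is a total operator, with a default value where the limit does not
   exist.  This predicate says that every limit occurring in grad f x and
   laplacian f x exists. *)
Definition has_laplacian f x : Prop :=
  forall i : 'I_n, (\forall z \near x, derivable f z (delta_mx 0 i)) /\
    derivable (partial i f) x (delta_mx 0 i).

End calculus.

Section half_space.
Context {R : realType} {n : nat}.

Definition half_space : set 'rV[R]_n.+1 := [set x | 0 < x 0 ord_max].

Definition dirichlet_heat_kernel (x y : 'rV[R]_n.+1) (t : R) : R :=
  ((4 * pi * t) `^ (n.+1%:R / 2))^-1 *
  expR (- (\sum_(i < n.+1 | i != ord_max) (x 0 i - y 0 i) ^+ 2) / (4 * t)) *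
  (expR (- (x 0 ord_max - y 0 ord_max) ^+ 2 / (4 * t)) -
   expR (- (x 0 ord_max + y 0 ord_max) ^+ 2 / (4 * t))).

End half_space.

(* Main.v *)
Require Import Defs.
From mathcomp Require Import all_boot all_order all_algebra.
From mathcomp Require Import all_classical all_reals all_analysis.
From mathcomp Require Import measurable_realfun ring lra.

Import Order.TTheory GRing.Theory Num.Theory.
Import numFieldNormedType.Exports.
Local Open Scope classical_set_scope.
Local Open Scope ring_scope.

(** Completing the square in the heat kernel gives, for fixed x and t,
  w(x,t) = c e^{-|x|^2/4t} F(x), where F is a superposition with nonnegative
  weights of the functions e^{x' . y'/2t} sinh(x_n y_n/2t).  The Gaussian factor
  contributes exactly - n/2t to the Laplacian of log w.  Each tangential
  direction contributes a nonnegative amount, since superpositions of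
  exponentials are log-convex.  In the normal direction, log sinh(u s) has second
  derivative - u^2/sinh^2(u s), which is at least - 1/s^2 because
  sinh(u s) >= u s; this is the term - 1/x_n^2.

  The bounds survive superposition for the following reason.  The inequality
  f''/f - (f'/f)^2 >= -k, for f > 0, says that the quadratic polynomial
  f'' - 2 l f' + (l^2 + k) f in l is nonnegative, a condition which is linear in
  (f, f', f'') for each l and hence passes to integrals
  (log_curvature_mixture).  Taking l = F'/F recovers the bound for the integral
  F.

  Everything is done on lines x + s e_i, through the predicate log_curvature_ge,
  and the bounds are summed over i at the end.  The finiteness of w is what
  allows differentiation under the integral: the s-derivatives of e^{us} and of
  sinh(us), for s in a bounded interval, are controlled by values of the same
  functions at larger |s|, and these are integrable against the weights because
  w is finite at all points of the half-space (expR_moments, sinh_moments).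
  Integrability also requires that the kernel be Lebesgue measurable, which
  reduces to the Caratheodory measurability of the half-spaces a < y_i
  (measurable_coordinate_gt). *)

(** * Lebesgue measurability of the coordinates *)

Section coordinates.
Context {R : realType} {n : nat}.
Implicit Types (c : 'rV[R]_n.+1 * 'rV[R]_n.+1) (i j : 'I_n.+1) (a : R).

Definition lower_box i a c : 'rV[R]_n.+1 * 'rV[R]_n.+1 :=
  (c.1, \row_j if j == i then Num.min (c.2 0 j) a else c.2 0 j).

Definition upper_box i a c : 'rV[R]_n.+1 * 'rV[R]_n.+1 :=
  (\row_j if j == i then Num.max (c.1 0 j) a else c.1 0 j, c.2).

Lemma box_volume_split i a c :
  box_volume (upper_box i a c) + box_volume (lower_box i a c) = box_volume c.
Proof.
have volE (e : 'rV[R]_n.+1 * 'rV[R]_n.+1) : box_volume e = Num.max 0 (e.2 0 i - e.1 0 i) *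
    \prod_(j < n.+1 | j != i) Num.max 0 (e.2 0 j - e.1 0 j).
  by rewrite /box_volume (bigD1 i).
rewrite !volE /= !mxE eqxx.
rewrite [X in _ * X + _](eq_bigr (fun j => Num.max 0 (c.2 0 j - c.1 0 j))); last first.
  by move=> j /negbTE ji; rewrite mxE ji.
rewrite [X in _ + _ * X](eq_bigr (fun j => Num.max 0 (c.2 0 j - c.1 0 j))); last first.
  by move=> j /negbTE ji; rewrite mxE ji.
rewrite -mulrDl; congr (_ * _).
rewrite !maxEle !minEle.
by case: (leP (c.1 0 i) a) => ?; case: (leP (c.2 0 i) a) => ?;
  repeat case: leP => ?; lra.
Qed.

(** The hyperplane y_i = a cuts every box of a cover into two boxes whose volumes
  add up, so cutting a cover of X yields covers of both parts of X at no cost. *)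
Lemma measurable_coordinate_gt i a :
  measurable ([set y : 'rV[R]_n.+1 | a < y 0 i] : set (leb_rV R n)).
Proof.
apply: (@le_caratheodory_measurable R _ (@lebesgue_outer R n)) => X.
apply: le_ereal_inf_tmp => _ [c Xc <-].
rewrite [leRHS](_ : _ = \sum_(0 <= k <oo) (box_volume (upper_box i a (c k)))%:E +
    \sum_(0 <= k <oo) (box_volume (lower_box i a (c k)))%:E)%E; last first.
  rewrite -nneseriesD//; last 2 first.
    by move=> k _ _; exact: box_volume_ge0.
    by move=> k _ _; exact: box_volume_ge0.
  by apply: eq_eseriesr => k _; rewrite -EFinD box_volume_split.
apply: leeD.
- apply: ereal_inf_lbound; exists (fun k => upper_box i a (c k)) => //.
  move=> y [/Xc[k _ yk] /= ay]; exists k => // j.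
  rewrite /= mxE; case: ifPn => [/eqP ->|_]; last exact: yk.
  by have /andP[h ->] := yk i; rewrite gt_max h ay.
- apply: ereal_inf_lbound; exists (fun k => lower_box i a (c k)) => //.
  move=> y [/Xc[k _ yk] /= /negP]; rewrite -leNgt => ya; exists k => // j.
  rewrite /= mxE; case: ifPn => [/eqP ->|_]; last exact: yk.
  by have /andP[-> h] := yk i; rewrite le_min h ya.
Qed.

Lemma measurable_coordinate i (D : set (leb_rV R n)) :
  measurable_fun D ((fun y => y 0 i) : leb_rV R n -> R).
Proof.
move=> mD; apply: (measurability _ (RGenOInfty.measurableE R)) => //.
move=> /= _ [_ [a ->] <-]; apply: measurableI => //.
suff -> : (fun y : leb_rV R n => (y : 'rV[R]_n.+1) 0 i) @^-1` `]a, +oo[%classic =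
    [set y | a < y 0 i] by exact: measurable_coordinate_gt.
by apply/seteqP; split=> y; rewrite /= in_itv/= andbT.
Qed.

Lemma measurable_half_space : measurable (half_space : set (leb_rV R n)).
Proof. exact: measurable_coordinate_gt. Qed.

End coordinates.

(** * Superpositions of log-semiconvex families *)

Section under.
Context {R : realType} {d : measure_display} {T : measurableType d}.
Context {mu : {measure set T -> \bar R}}.

(** The derivative of the parameter integral, in terms of an explicit f' instead
  of the chosen derivative of f; the dominating G may be negative off D. *)
Lemma is_derive_under_integral {D : set T} {a b : R} {f f' : R -> T -> R}
    {G : T -> R} : measurable D ->
  (forall (s : R), `]a, b[%classic s -> mu.-integrable D (EFin \o f s)) ->
  (forall (s : R) y, `]a, b[%classic s -> D y -> is_derive s (1 : R) (f ^~ y) (f' s y)) ->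
  mu.-integrable D (EFin \o G) ->
  (forall (s : R) y, `]a, b[%classic s -> D y -> `|f' s y| <= G y) ->
  forall s : R, `]a, b[%classic s ->
    is_derive s (1 : R) (fun s => \int[mu]_(y in D) f s y) (\int[mu]_(y in D) f' s y).
Proof.
move=> mD intf df intG fG s Is.
have f'E s' y : `]a, b[%classic s' -> D y -> partial1of2 f s' y = f' s' y.
  by move=> Is' Dy; rewrite partial1of2E; have [] := df s' y Is' Dy.
have derf s' y : `]a, b[%classic s' -> D y -> derivable (f ^~ y) s' 1.
  by move=> Is' Dy; have [] := df s' y Is' Dy.
have intG' : mu.-integrable D (EFin \o (Num.norm \o G)).
  exact: integrable_abse intG.
have G'ub s' y : `]a, b[%classic s' -> D y ->
    `|partial1of2 f s' y| <= (Num.norm \o G) y.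
  by move=> Is' Dy; rewrite f'E//= (le_trans (fG _ _ Is' Dy))// ler_norm.
apply: DeriveDef.
  apply: (derivable_under_integral mD Is intf derf _ intG' G'ub) => y.
  exact: normr_ge0.
rewrite -derive1E.
rewrite (differentiation_under_integral mD Is intf derf _ intG' G'ub).
  by apply: eq_Rintegral => y /set_mem Dy; rewrite f'E.
by move=> y; exact: normr_ge0.
Qed.

(** The bound (log f)'' >= -k at 0, written without the logarithm, together with
  the existence of all the derivatives which a second derivative at 0 involves. *)
Definition log_curvature_ge (k : R) (f : R -> R) : Prop :=
  exists (f' : R -> R) (f'' : R),
  [/\ \forall s \near (0 : R), is_derive (s : R) (1 : R) f (f' s), is_derive (0 : R) (1 : R) f' f'' &
      f'' / f 0 - (f' 0 / f 0) ^+ 2 >= - k].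

(** The hypothesis on the quadratic polynomial in l is the pointwise bound
  f f'' - f'^2 >= - k f^2 in a form that is linear in f, so it can be integrated.
  For the integral F it is used at l = F'/F, the minimum point of the integrated
  polynomial. *)
Lemma log_curvature_mixture {D : set T} {r k : R} {f f' f'' : R -> T -> R}
    {G : T -> R} : measurable D -> 0 < r ->
  (forall (s : R), `]- r, r[%classic s -> mu.-integrable D (EFin \o f s)) ->
  (forall (s : R), `]- r, r[%classic s -> measurable_fun D (f' s)) ->
  measurable_fun D (f'' 0) ->
  (forall (s : R) y, `]- r, r[%classic s -> D y -> is_derive s (1 : R) (f ^~ y) (f' s y)) ->
  (forall (s : R) y, `]- r, r[%classic s -> D y -> is_derive s (1 : R) (f' ^~ y) (f'' s y)) ->
  mu.-integrable D (EFin \o G) ->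
  (forall (s : R) y, `]- r, r[%classic s -> D y -> `|f' s y| <= G y) ->
  (forall (s : R) y, `]- r, r[%classic s -> D y -> `|f'' s y| <= G y) ->
  (forall l y, D y -> 0 <= f'' 0 y - 2 * l * f' 0 y + (l ^+ 2 + k) * f 0 y) ->
  0 < \int[mu]_(y in D) f 0 y ->
  log_curvature_ge k (fun s => \int[mu]_(y in D) f s y).
Proof.
move=> mD r0 intf mf' mf'' df df' intG f'G f''G quad F0.
have I0 : `]- r, r[%classic (0 : R) by rewrite /= in_itv/= oppr_lt0 r0.
have dom (h : T -> R) : measurable_fun D h -> (forall y, D y -> `|h y| <= G y) ->
    mu.-integrable D (EFin \o h).
  move=> mh hG; apply: (le_integrable mD _ _ intG).
    exact/measurable_EFinP.
  by move=> y Dy; rewrite /= lee_fin (le_trans (hG y Dy))// ler_norm.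
have intf' s : `]- r, r[%classic s -> mu.-integrable D (EFin \o f' s).
  by move=> Is; apply: dom => [|y Dy]; [exact: mf'|exact: f'G].
have intf'' : mu.-integrable D (EFin \o f'' 0).
  by apply: dom => // y Dy; exact: f''G.
exists (fun s => \int[mu]_(y in D) f' s y), (\int[mu]_(y in D) f'' 0 y); split.
- near=> s.
  have Is : `]- r, r[%classic s by near: s; exact: near_in_itvoo.
  exact: (is_derive_under_integral mD intf df intG f'G _ Is).
- exact: (is_derive_under_integral mD intf' df' intG f''G _ I0).
- set F := \int[mu]_(y in D) f 0 y in F0 *.
  set F' := \int[mu]_(y in D) f' 0 y.
  set F'' := \int[mu]_(y in D) f'' 0 y.
  have scal (c : R) (h : T -> R) : mu.-integrable D (EFin \o h) ->
      mu.-integrable D (EFin \o (fun y => c * h y)).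
    move=> inth; rewrite [X in mu.-integrable D X](_ : _ = fun y => c%:E * (h y)%:E)%E //.
    exact: integrableZl.
  have : 0 <= F'' - 2 * (F' / F) * F' + ((F' / F) ^+ 2 + k) * F.
    rewrite /F'' {2}/F' {3}/F -RintegralZl//; last exact: intf'.
    rewrite -RintegralZl//; last exact: intf.
    have i1 := scal (2 * (F' / F)) _ (intf' _ I0).
    have i2 := scal ((F' / F) ^+ 2 + k) _ (intf _ I0).
    rewrite -RintegralB// -RintegralD//; last exact: (integrableB mD intf'' i1).
    by apply: Rintegral_ge0 => y Dy; exact: quad.
  move=> H; have : 0 <= (F'' - 2 * (F' / F) * F' + ((F' / F) ^+ 2 + k) * F) / F.
    by rewrite divr_ge0// ltW.
  rewrite [X in 0 <= X](_ : _ = F'' / F - (F' / F) ^+ 2 + k); first lra.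
  by field; rewrite gt_eqF.
Unshelve. all: by end_near. Qed.

End under.

(** * The exponential and hyperbolic families *)

Section scalar.
Context {R : realType}.
Implicit Types b l s u v : R.

Lemma le_two_sinh v : 0 <= v -> 2 * v <= expR v - expR (- v).
Proof.
move=> v0.
pose f w : R := expR w - expR (- w) - 2 * w.
have df (w : R) : is_derive w (1 : R) f (expR w + expR (- w) - 2).
  rewrite /f; apply: is_derive_eq.
  by rewrite mulrN1 opprK /GRing.scale/= mulr1.
have : f 0 <= f v.
  have f'_ge0 (w : R) : w \in `]0, v[ -> 0 <= derive1 f w.
    move=> _; rewrite derive1E derive_val expRN.
    have e0 := expR_gt0 w; rewrite (_ : _ + _ - 2 = (expR w - 1) ^+ 2 / expR w).
      by rewrite divr_ge0 ?sqr_ge0// ltW.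
    by field; rewrite gt_eqF.
  have df' (w : R) : w \in `]0, v[ -> derivable f w 1 by [].
  apply: (ger0_derive1_ndecr df' f'_ge0 _ (lexx 0) v0 (lexx v)).
  by apply: derivable_within_continuous.
by rewrite /f oppr0 subrr mulr0 subr0 subr_ge0.
Qed.

(** For |s| < 1 the moments |u|^k e^{su}, k = 1, 2, are dominated by the members
  s = 2 and s = -2 of the family. *)
Lemma expR_moments s u : -1 < s -> s < 1 ->
  `|u * expR (s * u)| <= 4 * (expR (2 * u) + expR (- 2 * u)) /\
  `|u ^+ 2 * expR (s * u)| <= 4 * (expR (2 * u) + expR (- 2 * u)).
Proof.
move=> s1 s2.
have su : expR (s * u) <= expR `|u|.
  rewrite ler_expR (le_trans (ler_norm _))// normrM ler_piMl//.
  by rewrite ler_norml !ltW.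
have u1 : `|u| <= expR `|u| by have := expR_ge1Dx `|u|; lra.
have u2 : `|u| * `|u| <= 4 * expR `|u|.
  have := expR_ge1Dx (`|u| / 2).
  move=> H.
  rewrite [in leRHS](_ : `|u| = `|u| / 2 + `|u| / 2); last by field.
  rewrite expRD; have := normr_ge0 u; nra.
have ub : expR `|u| * expR `|u| <= expR (2 * u) + expR (- 2 * u).
  rewrite -expRD; have [u0|u0] := leP 0 u.
    by rewrite ger0_norm// mulrDl mul1r lerDl expR_ge0.
  rewrite ltr0_norm// (_ : - u + - u = - 2 * u); last by ring.
  by rewrite lerDr expR_ge0.
have e0 := expR_gt0 `|u|; have e1 := expR_gt0 (s * u); have n0 := normr_ge0 u.
have ub0 : 0 <= expR (2 * u) + expR (- 2 * u) by rewrite addr_ge0 ?expR_ge0.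
rewrite !normrM !(ger0_norm (expR_ge0 _)).
split.
  apply: (@le_trans _ _ (expR `|u| * expR `|u|)); last by lra.
  by rewrite ler_pM// ltW.
apply: (@le_trans _ _ (4 * expR `|u| * expR `|u|)); last by lra.
by rewrite ler_pM ?mulr_ge0// ltW.
Qed.

Lemma sinh_mono s s' u : 0 <= u -> s <= s' ->
  expR (s * u) - expR (- (s * u)) <= expR (s' * u) - expR (- (s' * u)).
Proof.
move=> u0 ss'; have : s * u <= s' * u by rewrite ler_wpM2r.
by move=> H; rewrite lerB ?ler_expR ?lerN2.
Qed.

(** Domination by the family itself also near u = 0, where the weights against
  which sinh is integrated may have infinite mass.  It follows from
  2 sinh((v+1)u) = sinh(vu) 2cosh(u) + cosh(vu) 2sinh(u) and sinh u >= u; the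
  second moment is two such steps. *)
Lemma sinh_moments s u : 0 <= s -> 0 <= u ->
  u * (expR (s * u) + expR (- (s * u))) <=
    expR ((s + 1) * u) - expR (- ((s + 1) * u)) /\
  u ^+ 2 * (expR (s * u) - expR (- (s * u))) <=
    expR ((s + 2) * u) - expR (- ((s + 2) * u)).
Proof.
move=> s0 u0.
have step v : 0 <= v -> u * (expR (v * u) + expR (- (v * u))) <=
    expR ((v + 1) * u) - expR (- ((v + 1) * u)).
  move=> v0.
  have := le_two_sinh _ u0; rewrite (_ : (v + 1) * u = v * u + u); last by ring.
  rewrite opprD !expRD.
  have : 0 <= v * u by exact: mulr_ge0.
  move: (v * u) => {v0}v v0.
  move=> sinhu.
  have e2 : 0 <= (expR v - expR (- v)) * (expR u + expR (- u)).
    apply: mulr_ge0; last by rewrite addr_ge0 ?expR_ge0.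
    by rewrite subr_ge0 ler_expR; lra.
  have e3 : 0 <= (expR v + expR (- v)) * (expR u - expR (- u) - 2 * u).
    by apply: mulr_ge0; [rewrite addr_ge0 ?expR_ge0 | rewrite subr_ge0].
  lra.
split; first exact: step.
have s10 : 0 <= s + 1 by lra.
have := step _ s10; rewrite (_ : s + 1 + 1 = s + 2); last by ring.
have := step _ s0.
have := expR_ge0 (- ((s + 1) * u)); have := expR_ge0 (- (s * u)); nra.
Qed.

(** With S = 2 sinh(bu) and C = 2 cosh(bu), S times the right-hand side equals
  (l S - u C)^2 + (S^2 - (2bu)^2)/b^2, because C^2 = S^2 + 4. *)
Lemma sinh_quadratic b l u : 0 < b -> 0 <= u ->
  0 <= u ^+ 2 * (expR (b * u) - expR (- (b * u)))
     - 2 * l * (u * (expR (b * u) + expR (- (b * u))))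
     + (l ^+ 2 + 1 / b ^+ 2) * (expR (b * u) - expR (- (b * u))).
Proof.
move=> b0; rewrite le_eqVlt => /predU1P[<-|u0].
  by rewrite mulr0 oppr0 subrr !mul0r !mulr0 subrr addr0.
have /ltW bu : 0 < b * u by exact: mulr_gt0.
have := le_two_sinh _ bu; rewrite expRN.
have := expR_gt0 (b * u); set E := expR (b * u) => E0 bS.
have S0 : 0 < E - E^-1 by apply: lt_le_trans bS; rewrite mulr_gt0// mulr_gt0.
(* the sign is unchanged after multiplication by S, which makes a square appear *)
rewrite -(pmulr_lge0 _ S0).
have -> : (u ^+ 2 * (E - E^-1) - 2 * l * (u * (E + E^-1)) +
    (l ^+ 2 + 1 / b ^+ 2) * (E - E^-1)) * (E - E^-1) =
    (l * (E - E^-1) - u * (E + E^-1)) ^+ 2 +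
    ((E - E^-1) ^+ 2 - (2 * (b * u)) ^+ 2) / b ^+ 2.
  by field; rewrite !gt_eqF.
rewrite addr_ge0 ?sqr_ge0// divr_ge0 ?sqr_ge0// subr_ge0.
have bu2 : 0 <= 2 * (b * u) by rewrite mulr_ge0.
by rewrite !expr2 ler_pM.
Qed.

End scalar.
Section families.
Context {R : realType} {d : measure_display} {T : measurableType d}.
Context {mu : {measure set T -> \bar R}}.

(** Laplace transforms of nonnegative weights are log-convex. *)
Lemma log_curvature_exp {D : set T} {u A : T -> R} : measurable D ->
  measurable_fun D u -> measurable_fun D A -> (forall y, D y -> 0 <= A y) ->
  (forall s : R, mu.-integrable D (EFin \o (fun y => expR (s * u y) * A y))) ->
  0 < \int[mu]_(y in D) (expR (0 * u y) * A y) ->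
  log_curvature_ge 0 (fun s => \int[mu]_(y in D) (expR (s * u y) * A y)).
Proof.
move=> mD mu_ mA A0 intA F0.
have me (s : R) : measurable_fun D (fun y => expR (s * u y)).
  by apply: measurableT_comp => //; exact: measurable_funM.
pose G y := 4 * (expR (2 * u y) * A y + expR (- 2 * u y) * A y).
have intG : mu.-integrable D (EFin \o G).
  rewrite [X in mu.-integrable D X](_ : _ = fun y => (4%:E *
     ((expR (2 * u y) * A y)%:E + (expR (- 2 * u y) * A y)%:E))%E) //.
  by apply: integrableZl => //; apply: integrableD => //; exact: intA.
have moments (s : R) y : `]-1, 1[%classic s -> D y ->
    `|u y * expR (s * u y) * A y| <= G y /\
    `|u y ^+ 2 * expR (s * u y) * A y| <= G y.
  rewrite /= in_itv/= => /andP[s1 s2] Dy; rewrite !(normrM _ (A y)).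
  rewrite (ger0_norm (A0 _ Dy)) /G -mulrDl mulrA.
  by have [? ?] := expR_moments s (u y) s1 s2; rewrite !ler_wpM2r ?A0.
apply: (@log_curvature_mixture _ _ _ mu D 1 0 _
  (fun s y => u y * expR (s * u y) * A y)
  (fun s y => u y ^+ 2 * expR (s * u y) * A y) G) => //.
- by move=> s _; apply: measurable_funM => //; exact: measurable_funM.
- apply: measurable_funM => //; apply: measurable_funM => //.
  exact: measurable_funX.
- move=> s y _ _; apply: is_derive_eq; rewrite /GRing.scale/=; ring.
- move=> s y _ _; apply: is_derive_eq; rewrite /GRing.scale/=; ring.
- by move=> s y Is Dy; have [] := moments s y Is Dy.
- by move=> s y Is Dy; have [] := moments s y Is Dy.
- move=> l y Dy; rewrite [leRHS](_ : _ =
    (u y - l) ^+ 2 * (expR (0 * u y) * A y)); last by ring.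
  by rewrite mulr_ge0 ?sqr_ge0// mulr_ge0 ?expR_ge0 ?A0.
Qed.

(** The bound - 1/b^2 is attained in the limit u -> 0, where sinh(us) behaves
  like a linear function of s; this is why the constant cannot be improved. *)
Lemma log_curvature_sinh {D : set T} {b : R} {u A : T -> R} : measurable D ->
  0 < b -> measurable_fun D u -> measurable_fun D A ->
  (forall y, D y -> 0 <= u y) -> (forall y, D y -> 0 <= A y) ->
  (forall s : R, 0 < s ->
    mu.-integrable D (EFin \o (fun y => (expR (s * u y) - expR (- (s * u y))) * A y))) ->
  0 < \int[mu]_(y in D) ((expR ((b + 0) * u y) - expR (- ((b + 0) * u y))) * A y) ->
  log_curvature_ge (1 / b ^+ 2) (fun s =>
    \int[mu]_(y in D) ((expR ((b + s) * u y) - expR (- ((b + s) * u y))) * A y)).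
Proof.
move=> mD b0 mu_ mA u0 A0 intA F0.
have me (s : R) : measurable_fun D (fun y => expR ((b + s) * u y)).
  by apply: measurableT_comp => //; exact: measurable_funM.
have meN (s : R) : measurable_fun D (fun y => expR (- ((b + s) * u y))).
  apply: measurableT_comp => //; apply: measurableT_comp => //.
  exact: measurable_funM.
(* b + s stays below 2 b, and sinh_moments shifts by at most 2 *)
pose G y := (expR ((2 * b + 2) * u y) - expR (- ((2 * b + 2) * u y))) * A y.
have intG : mu.-integrable D (EFin \o G) by apply: intA; lra.
have moments (s : R) y : `]- b, b[%classic s -> D y ->
    `|u y * (expR ((b + s) * u y) + expR (- ((b + s) * u y))) * A y| <= G y /\
    `|u y ^+ 2 * (expR ((b + s) * u y) - expR (- ((b + s) * u y))) * A y| <= G y.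
  rewrite /= in_itv/= => /andP[s1 s2] Dy.
  have uy := u0 _ Dy; have Ay := A0 _ Dy.
  have bs : 0 <= b + s by lra.
  have [m1 m2] := sinh_moments (b + s) (u y) bs uy.
  have l1 : b + s + 1 <= 2 * b + 2 by lra.
  have l2 : b + s + 2 <= 2 * b + 2 by lra.
  have g1 := le_trans m1 (sinh_mono _ _ _ uy l1).
  have g2 := le_trans m2 (sinh_mono _ _ _ uy l2).
  have := sinh_mono _ _ _ uy bs; rewrite mul0r oppr0 subrr => S0.
  split; rewrite ger0_norm; first exact: ler_wpM2r.
  - by apply: mulr_ge0 => //; rewrite mulr_ge0// addr_ge0 ?expR_ge0.
  - exact: ler_wpM2r.
  - by apply: mulr_ge0 => //; rewrite mulr_ge0// sqr_ge0.
apply: (@log_curvature_mixture _ _ _ mu D b (1 / b ^+ 2) _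
  (fun s y => u y * (expR ((b + s) * u y) + expR (- ((b + s) * u y))) * A y)
  (fun s y => u y ^+ 2 * (expR ((b + s) * u y) - expR (- ((b + s) * u y))) * A y)
  G) => //.
- by move=> s; rewrite /= in_itv/= => /andP[s1 s2]; apply: intA; lra.
- move=> s _; apply: measurable_funM => //; apply: measurable_funM => //.
  exact: measurable_funD.
- apply: measurable_funM => //; apply: measurable_funM => //.
    exact: measurable_funX.
  exact: measurable_funB.
- move=> s y _ _; apply: is_derive_eq; rewrite /GRing.scale/=; ring.
- move=> s y _ _; apply: is_derive_eq; rewrite /GRing.scale/=; ring.
- by move=> s y Is Dy; have [] := moments s y Is Dy.
- by move=> s y Is Dy; have [] := moments s y Is Dy.
- move=> l y Dy; rewrite addr0.
  have := mulr_ge0 (sinh_quadratic b l (u y) b0 (u0 _ Dy)) (A0 _ Dy).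
  by congr (0 <= _); ring.
Qed.

End families.

(** * Calculus of logarithmic curvature *)

Section calculus.
Context {R : realType}.
Implicit Types f g : R -> R.

Lemma is_derive_continuous f (x df : R) :
  is_derive x (1 : R) f df -> {for x, continuous f}.
Proof. by move=> [/derivable1_diffP/differentiable_continuous]. Qed.

Lemma log_curvature_near (k : R) f g : (\forall s \near (0 : R), f s = g s) ->
  log_curvature_ge k f -> log_curvature_ge k g.
Proof.
move=> fg [f' [f'' [df df' kf]]]; exists f', f''; split => //.
- have fg2 := near_join fg.
  near=> s.
  have fgs : \forall z \near s, f z = g z by near: s.
  by apply: (near_eq_is_derive fgs); near: s.
- by rewrite -(nbhs_singleton fg).
Unshelve. all: by end_near. Qed.

(** The logarithm of a product is the sum of the logarithms, so bounds on
  curvature add up. *)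
Lemma log_curvature_mul (k l : R) f g : f 0 != 0 -> g 0 != 0 ->
  log_curvature_ge k f -> log_curvature_ge l g ->
  log_curvature_ge (k + l) (fun s => f s * g s).
Proof.
move=> f0 g0 [f' [f'' [df df' kf]]] [g' [g'' [dg dg' lg]]].
exists (fun s => f' s * g s + f s * g' s).
exists (f'' * g 0 + 2 * f' 0 * g' 0 + f 0 * g''); split.
- near=> s.
  have dfs : is_derive s (1 : R) f (f' s) by near: s.
  have dgs : is_derive s (1 : R) g (g' s) by near: s.
  by apply: is_derive_eq; rewrite /GRing.scale/=; ring.
- have df0 := nbhs_singleton df; have dg0 := nbhs_singleton dg.
  by apply: is_derive_eq; rewrite /GRing.scale/=; ring.
- rewrite [leRHS](_ : _ = f'' / f 0 - (f' 0 / f 0) ^+ 2 +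
    (g'' / g 0 - (g' 0 / g 0) ^+ 2)); first lra.
  by field; rewrite f0 g0.
Unshelve. all: by end_near. Qed.

(** This is an equality: the logarithm is a quadratic polynomial with second
  derivative - 1/(2t). *)
Lemma log_curvature_gauss (b t : R) : 0 < t ->
  log_curvature_ge (1 / (2 * t)) (fun s => expR (- (2 * b * s + s ^+ 2) / (4 * t))).
Proof.
move=> t0; have t4 : 4 * t != 0 by rewrite gt_eqF// mulr_gt0.
pose G (s : R) := expR (- (2 * b * s + s ^+ 2) / (4 * t)).
have dG (s : R) : is_derive s (1 : R) G (- (b + s) / (2 * t) * G s).
  apply: is_derive_eq; rewrite /GRing.scale/= /G; field.
  by rewrite gt_eqF.
exists (fun s => - (b + s) / (2 * t) * G s).
exists ((- 1 / (2 * t) + (- b / (2 * t)) ^+ 2) * G 0); split.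
- by near=> s; exact: dG.
- apply: is_derive_eq; rewrite /GRing.scale/= ; field.
  by rewrite gt_eqF.
- rewrite -/(G 0) [leRHS](_ : _ = - (1 / (2 * t)))//; field.
  by rewrite !gt_eqF// expR_gt0.
Unshelve. all: by end_near. Qed.

Lemma log_curvature_ln (k : R) f : 0 < f 0 -> log_curvature_ge k f ->
  exists (h : R -> R) (h' : R),
  [/\ \forall s \near (0 : R), is_derive (s : R) (1 : R) (fun s => ln (f s)) (h s),
      is_derive (0 : R) (1 : R) h h' & - k <= h'].
Proof.
move=> f0 [f' [f'' [df df' kf]]].
have df0 := nbhs_singleton df.
have f_gt0 : \forall s \near (0 : R), 0 < f s.
  exact: (cvgr_gt _ (is_derive_continuous _ _ _ df0) _ f0).
exists (fun s => f' s / f s), (f'' / f 0 - (f' 0 / f 0) ^+ 2); split => //.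
- near=> s.
  have fs : 0 < f s by near: s.
  have dfs : is_derive s (1 : R) f (f' s) by near: s.
  have dln := is_derive1_ln fs.
  have := is_derive1_comp dln dfs.
  by rewrite mulrC.
- have fn0 : f 0 != 0 by rewrite gt_eqF.
  have dV := is_deriveV fn0 df0.
  by apply: is_derive_eq; rewrite /GRing.scale/=; field.
Unshelve. all: by end_near. Qed.

End calculus.

(** * Partial derivatives along coordinate lines *)

Section lines.
Context {R : realType} {n : nat}.
Implicit Types (F : 'rV[R]_n -> R) (x v : 'rV[R]_n).

Lemma is_derive_line F x v (s d : R) :
  is_derive s (1 : R) (fun h : R => F (x + h *: v)) d ->
  is_derive (x + s *: v) v F d.
Proof.
have E : (fun h : R => h^-1 *: ((F \o shift (x + s *: v)) (h *: v) - F (x + s *: v))) =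
    (fun h : R => h^-1 *: (((fun h : R => F (x + h *: v)) \o shift s) (h *: 1) -
      F (x + s *: v))).
  apply/funext => h /=; congr (_ *: (F _ - _)).
  have -> : h *: (1 : R) = h by rewrite /GRing.scale/= mulr1.
  by rewrite scalerDl addrCA.
by move=> [dF DF]; split; rewrite /derivable /derive E.
Qed.

(** Near x on the line, the first partial derivative of F is f', so the second one
  is the derivative of f'. *)
Lemma partial_line F x (i : 'I_n) (f' : R -> R) (f'' : R) :
  (\forall s \near (0 : R),
     is_derive (s : R) (1 : R) (fun s : R => F (x + s *: delta_mx 0 i)) (f' s)) ->
  is_derive (0 : R) (1 : R) f' f'' ->
  [/\ is_derive x (delta_mx 0 i) F (f' 0), partial i F x = f' 0,
      derivable (partial i F) x (delta_mx 0 i) &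
      partial i (partial i F) x = f''].
Proof.
move=> dF df'.
have x0 : x = x + (0 : R) *: delta_mx 0 i by rewrite scale0r addr0.
have dFx : is_derive x (delta_mx 0 i) F (f' 0).
  by rewrite x0; apply: is_derive_line; exact: nbhs_singleton dF.
have dpF : is_derive x (delta_mx 0 i) (partial i F) f''.
  rewrite x0; apply: is_derive_line; apply: near_eq_is_derive df'.
  near=> s; apply/esym; rewrite /partial.
  have dFs : is_derive s (1 : R) (fun s : R => F (x + s *: delta_mx 0 i)) (f' s).
    by near: s.
  by have [_ ->] := is_derive_line _ _ _ _ _ dFs.
by split => //; case: dFx; case: dpF.
Unshelve. all: by end_near. Qed.

End lines.

(** * The Dirichlet heat kernel *)

Section measurability.
Context {R : realType} {d : measure_display} {T : measurableType d}.
Context {D : set T}.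

Lemma measurable_gaussian {v : T -> R} (c : R) : measurable_fun D v ->
  measurable_fun D (fun y => expR (- v y / c)).
Proof.
move=> mv; apply: measurableT_comp => //; apply: measurable_funM => //.
exact: measurableT_comp.
Qed.

Lemma measurable_sqr_dist {I : Type} (r : seq I) (P : pred I) (a : I -> R)
    {v : I -> T -> R} : (forall i, measurable_fun D (v i)) ->
  measurable_fun D (fun y => \sum_(i <- r | P i) (a i - v i y) ^+ 2).
Proof.
move=> mv; under eq_fun do rewrite big_mkcond/=.
apply: measurable_sum => i; case: (P i) => //.
by apply: measurable_funX; exact: measurable_funB.
Qed.

End measurability.

Section kernel.
Context {R : realType} {n : nat}.
Implicit Types (x y : 'rV[R]_n.+1) (s t : R) (i : 'I_n.+1).

(** The factor by which e^{-b^2/4t} changes when b moves to b + s. *)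
Definition gauss (b t s : R) : R := expR (- (2 * b * s + s ^+ 2) / (4 * t)).

(** The heat kernel up to its factor in the last coordinate. *)
Definition tangential_gauss t x y : R :=
  ((4 * pi * t) `^ (n.+1%:R / 2))^-1 *
  expR (- (\sum_(i < n.+1 | i != ord_max) (x 0 i - y 0 i) ^+ 2) / (4 * t)).

Lemma coord_shift x i s j :
  (x + s *: delta_mx 0 i) 0 j = if j == i then x 0 i + s else x 0 j.
Proof.
rewrite !mxE eqxx /=; case: eqP => [->|_]; first by rewrite mulr1.
by rewrite mulr0 addr0.
Qed.

Lemma kernel_shift_tangential x y s t i : 0 < t -> i != ord_max ->
  dirichlet_heat_kernel (x + s *: delta_mx 0 i) y t =
  gauss (x 0 i) t s * (expR (s * (y 0 i / (2 * t))) * dirichlet_heat_kernel x y t).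
Proof.
move=> t0 iN; rewrite /dirichlet_heat_kernel coord_shift eq_sym (negbTE iN).
rewrite (bigD1 i)//= coord_shift eqxx [in RHS](bigD1 i)//=.
rewrite (eq_bigr (fun j => (x 0 j - y 0 j) ^+ 2)); last first.
  by move=> j /andP[_ ji]; rewrite coord_shift (negbTE ji).
set S := \sum_(j < n.+1 | _) _; set c := _^-1; set d := (expR _ - expR _).
rewrite (_ : - ((x 0 i + s - y 0 i) ^+ 2 + S) / (4 * t) =
   - (2 * x 0 i * s + s ^+ 2) / (4 * t) + s * (y 0 i / (2 * t)) +
   - ((x 0 i - y 0 i) ^+ 2 + S) / (4 * t)); last by field; rewrite gt_eqF.
by rewrite !expRD /gauss; ring.
Qed.

(** The image term e^{-(x_n+y_n)^2/4t} is the direct term with y_n replaced by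
  - y_n, so after completing the square the two combine into a hyperbolic sine.
  The weight is written without dividing the kernel by the sinh. *)
Lemma kernel_shift_normal x y s t : 0 < t ->
  let u := y 0 ord_max / (2 * t) in
  let b := x 0 ord_max in
  dirichlet_heat_kernel (x + s *: delta_mx 0 ord_max) y t =
  gauss b t s * ((expR ((b + s) * u) - expR (- ((b + s) * u))) *
    (tangential_gauss t x y * expR (- (b ^+ 2 + y 0 ord_max ^+ 2) / (4 * t)))).
Proof.
move=> t0 u b; rewrite /dirichlet_heat_kernel coord_shift eqxx -/b.
rewrite (eq_bigr (fun j => (x 0 j - y 0 j) ^+ 2)); last first.
  by move=> j ji; rewrite coord_shift (negbTE ji).
rewrite -/(tangential_gauss t x y) /gauss.
set v := y 0 ord_max.
rewrite (_ : - (b + s - v) ^+ 2 / (4 * t) = - (2 * b * s + s ^+ 2) / (4 * t) +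
  (b + s) * u + - (b ^+ 2 + v ^+ 2) / (4 * t)); last first.
  by rewrite /u -/v; field; rewrite gt_eqF.
rewrite (_ : - (b + s + v) ^+ 2 / (4 * t) = - (2 * b * s + s ^+ 2) / (4 * t) +
  - ((b + s) * u) + - (b ^+ 2 + v ^+ 2) / (4 * t)); last first.
  by rewrite /u -/v; field; rewrite gt_eqF.
by rewrite !expRD; ring.
Qed.

Lemma tangential_gauss_ge0 t x y : 0 <= tangential_gauss t x y.
Proof. by rewrite mulr_ge0 ?expR_ge0// invr_ge0 powR_ge0. Qed.

Lemma dirichlet_heat_kernel_ge0 x y t : half_space x -> half_space y ->
  0 < t -> 0 <= dirichlet_heat_kernel x y t.
Proof.
rewrite /half_space /= => x0 y0 t0.
rewrite /dirichlet_heat_kernel -/(tangential_gauss t x y).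
rewrite mulr_ge0 ?tangential_gauss_ge0// subr_ge0 ler_expR.
rewrite ler_pM2r; last by rewrite invr_gt0 mulr_gt0.
by rewrite lerN2; have := mulr_gt0 x0 y0; nra.
Qed.

Lemma measurable_tangential_gauss t x D :
  measurable_fun D (tangential_gauss t x : leb_rV R n -> R).
Proof.
apply: measurable_funM; first exact: measurable_cst.
apply: measurable_gaussian; apply: measurable_sqr_dist => i.
exact: measurable_coordinate.
Qed.

Lemma measurable_dirichlet_heat_kernel t x D :
  measurable_fun D ((fun y => dirichlet_heat_kernel x y t) : leb_rV R n -> R).
Proof.
apply: measurable_funM; first exact: measurable_tangential_gauss.
have my := @measurable_coordinate R n ord_max D.
apply: measurable_funB; apply: measurable_gaussian; apply: measurable_funX.
- by apply: measurable_funB; [exact: measurable_cst|exact: my].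
- by apply: measurable_funD; [exact: measurable_cst|exact: my].
Qed.

End kernel.

(** * Logarithmic curvature of the solution *)

Section solution.
Context {R : realType} {n : nat}.
Context {g : 'rV[R]_n.+1 -> R} {w : 'rV[R]_n.+1 -> R -> R}.
Context (g_ge0 : forall y, half_space y -> 0 <= g y).
Context (g_meas :
  measurable_fun (half_space : set (leb_rV R n)) (g : leb_rV R n -> R)).
Context (wE : forall (x : 'rV[R]_n.+1) (t : R), half_space x -> 0 < t ->
  (w x t)%:E = (\int[lebesgue_rV]_(y in (half_space : set (leb_rV R n)))
                  (dirichlet_heat_kernel x y t * g y)%:E)%E).
Context (w_gt0 :
  forall (x : 'rV[R]_n.+1) (t : R), half_space x -> 0 < t -> 0 < w x t).

Let D : set (leb_rV R n) := half_space.
Let mu : {measure set (leb_rV R n) -> \bar R} := lebesgue_rV.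

Let mD : measurable D.
Proof. exact: measurable_half_space. Qed.

Lemma integrable_kernel (x : 'rV[R]_n.+1) (t : R) : half_space x -> 0 < t ->
  mu.-integrable D (EFin \o (fun y => dirichlet_heat_kernel x y t * g y)).
Proof.
move=> x0 t0; apply/integrableP; split.
  apply/measurable_EFinP; apply: measurable_funM; last exact: g_meas.
  exact: measurable_dirichlet_heat_kernel.
rewrite (eq_integral (fun y : leb_rV R n => (dirichlet_heat_kernel x y t * g y)%:E)).
  by have := wE _ _ x0 t0; rewrite /D /mu => <-; exact: ltry.
move=> y /set_mem Dy /=; rewrite ger0_norm//.
by rewrite mulr_ge0 ?g_ge0// dirichlet_heat_kernel_ge0.
Qed.

(** When the kernel factors as c k, with c independent of y, the weight k inherits
  the integrability of the kernel, which is the finiteness of w at x. *)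
Lemma solution_factor (x : 'rV[R]_n.+1) (t c : R) (k : leb_rV R n -> R) :
  half_space x -> 0 < t -> 0 < c ->
  (forall y, D y -> dirichlet_heat_kernel x y t * g y = c * k y) ->
  mu.-integrable D (EFin \o k) /\ w x t = c * \int[mu]_(y in D) k y.
Proof.
move=> x0 t0 c0 kE.
have intk : mu.-integrable D (EFin \o k).
  apply: (eq_integrable mD (fun y : leb_rV R n => c^-1%:E *
      (dirichlet_heat_kernel x y t * g y)%:E)%E).
    by move=> y /set_mem Dy; rewrite kE//= -EFinM mulKf// gt_eqF.
  by apply: integrableZl => //; exact: integrable_kernel.
split => //; rewrite -RintegralZl// /Rintegral.
rewrite (eq_integral (fun y : leb_rV R n => (dirichlet_heat_kernel x y t * g y)%:E)).
  by have := wE _ _ x0 t0; rewrite /D /mu => <-.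
by move=> y /set_mem Dy; rewrite kE.
Qed.

Lemma half_space_shift (x : 'rV[R]_n.+1) (s : R) i : i != ord_max ->
  half_space x -> half_space (x + s *: delta_mx 0 i).
Proof. by move=> iN; rewrite /half_space /= coord_shift eq_sym (negbTE iN). Qed.

Lemma measurable_scaled_coordinate i (c : R) :
  measurable_fun D ((fun y : 'rV[R]_n.+1 => y 0 i / c) : leb_rV R n -> R).
Proof.
apply: measurable_funM; last exact: measurable_cst.
exact: measurable_coordinate.
Qed.

Lemma log_curvature_tangential (x : 'rV[R]_n.+1) (t : R) i :
  half_space x -> 0 < t -> i != ord_max ->
  log_curvature_ge (1 / (2 * t)) (fun s => w (x + s *: delta_mx 0 i) t).
Proof.
move=> x0 t0 iN.
pose A (y : leb_rV R n) := dirichlet_heat_kernel x y t * g y.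
pose u (y : leb_rV R n) := (y : 'rV[R]_n.+1) 0 i / (2 * t).
pose F s := \int[mu]_(y in D) (expR (s * u y) * A y).
have G0 s : 0 < gauss (x 0 i) t s by exact: expR_gt0.
have fact s : mu.-integrable D (EFin \o (fun y => expR (s * u y) * A y)) /\
    w (x + s *: delta_mx 0 i) t = gauss (x 0 i) t s * F s.
  apply: solution_factor => //; first exact: half_space_shift.
  move=> y Dy; rewrite kernel_shift_tangential//.
  by rewrite -[LHS]mulrA -[X in _ * X = _]mulrA.
have F0 : 0 < F 0.
  by rewrite -(pmulr_rgt0 _ (G0 0)) -(fact 0).2 scale0r addr0 w_gt0.
apply: (log_curvature_near _ (fun s => gauss (x 0 i) t s * F s)).
  by near=> s; rewrite (fact s).2.
rewrite -[1 / _]addr0; apply: log_curvature_mul.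
- by rewrite gt_eqF.
- by rewrite gt_eqF.
- exact: log_curvature_gauss.
- apply: (log_curvature_exp mD _ _ _ _ F0).
  + exact: measurable_scaled_coordinate.
  + apply: measurable_funM; last exact: g_meas.
    exact: measurable_dirichlet_heat_kernel.
  + by move=> y Dy; rewrite mulr_ge0 ?g_ge0// dirichlet_heat_kernel_ge0.
  + by move=> s; exact: (fact s).1.
Unshelve. all: by end_near. Qed.

(** On x + s e_n the representation holds only for s > - x_n, where the point is
  in the half-space; this suffices since log_curvature_ge is local at s = 0. *)
Lemma log_curvature_normal (x : 'rV[R]_n.+1) (t : R) :
  half_space x -> 0 < t ->
  log_curvature_ge (1 / (2 * t) + 1 / x 0 ord_max ^+ 2)
    (fun s => w (x + s *: delta_mx 0 ord_max) t).
Proof.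
move=> x0 t0; set b := x 0 ord_max; have b0 : 0 < b by exact: x0.
pose A (y : leb_rV R n) := tangential_gauss t x y *
  expR (- (b ^+ 2 + (y : 'rV[R]_n.+1) 0 ord_max ^+ 2) / (4 * t)) * g y.
pose u (y : leb_rV R n) := (y : 'rV[R]_n.+1) 0 ord_max / (2 * t).
pose f s (y : leb_rV R n) :=
  (expR ((b + s) * u y) - expR (- ((b + s) * u y))) * A y.
pose F s := \int[mu]_(y in D) f s y.
have G0 s : 0 < gauss b t s by exact: expR_gt0.
have fact s : 0 < b + s -> mu.-integrable D (EFin \o f s) /\
    w (x + s *: delta_mx 0 ord_max) t = gauss b t s * F s.
  move=> bs; apply: solution_factor => //.
    by rewrite /half_space /= coord_shift eqxx.
  move=> y Dy; rewrite kernel_shift_normal//.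
  by rewrite -[LHS]mulrA -[X in _ * X = _]mulrA.
have F0 : 0 < F 0.
  rewrite -(pmulr_rgt0 _ (G0 0)) -(fact 0 _).2; last by rewrite addr0.
  by rewrite scale0r addr0 w_gt0.
apply: (log_curvature_near _ (fun s => gauss b t s * F s)).
  near=> s; rewrite (fact s _).2//.
  have : - b < s by near: s; apply: (cvgr_gt (0 : R)) => //; rewrite oppr_lt0.
  lra.
apply: log_curvature_mul.
- by rewrite gt_eqF.
- by rewrite gt_eqF.
- exact: log_curvature_gauss.
- apply: (log_curvature_sinh mD b0 _ _ _ _ _ F0).
  + exact: measurable_scaled_coordinate.
  + apply: measurable_funM; last exact: g_meas.
    apply: measurable_funM; first exact: measurable_tangential_gauss.
    apply: measurable_gaussian; apply: measurable_funD.
      exact: measurable_cst.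
    by apply: measurable_funX; exact: measurable_coordinate.
  + by move=> y Dy; rewrite divr_ge0 ?mulr_ge0 ?(ltW t0)// ltW.
  + move=> y Dy; rewrite mulr_ge0 ?g_ge0//.
    by rewrite mulr_ge0 ?tangential_gauss_ge0 ?expR_ge0.
  + move=> s s0; have := (fact (s - b) _).1.
    by rewrite /f addrC subrK; apply.
Unshelve. all: by end_near. Qed.

Lemma log_curvature_solution (x : 'rV[R]_n.+1) (t : R) i :
  half_space x -> 0 < t ->
  log_curvature_ge
    (1 / (2 * t) + (if i == ord_max then 1 / x 0 ord_max ^+ 2 else 0))
    (fun s => w (x + s *: delta_mx 0 i) t).
Proof.
move=> x0 t0; case: eqVneq => [->|iN]; first exact: log_curvature_normal.
by rewrite addr0; exact: log_curvature_tangential.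
Qed.

End solution.

(** * The Laplacian *)

Section laplacian.
Context {R : realType} {n : nat}.

Lemma near_half_space (x : 'rV[R]_n.+1) : half_space x ->
  \forall z \near x, half_space z.
Proof.
move=> x0; exact: (cvgr_gt _ (@coord_continuous R 1 n.+1 0 ord_max x) _ x0).
Qed.

Lemma has_laplacian_half_space (F : 'rV[R]_n.+1 -> R) x :
  (forall z (i : 'I_n.+1), half_space z -> exists (f' : R -> R) (f'' : R),
    (\forall s \near (0 : R), is_derive (s : R) (1 : R)
      (fun s : R => F (z + s *: delta_mx 0 i)) (f' s)) /\
    is_derive (0 : R) (1 : R) f' f'') ->
  half_space x -> has_laplacian F x.
Proof.
move=> H x0 i; split.
  near=> z; have z0 : half_space z by near: z; exact: near_half_space.
  have [f' [f'' [df df']]] := H z i z0.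
  by have [[dF _] _ _ _] := partial_line _ _ _ _ _ df df'.
have [f' [f'' [df df']]] := H x i x0.
by have [_ _ ? _] := partial_line _ _ _ _ _ df df'.
Unshelve. all: by end_near. Qed.

Lemma sum_curvature_bounds (a b : R) :
  \sum_(i < n.+1) - (1 / a + (if i == ord_max then b else 0)) =
  - (n.+1%:R / a) - b.
Proof.
under eq_bigr do rewrite opprD.
rewrite big_split/= !sumrN sumr_const card_ord -big_mkcond/= big_pred1_eq.
by rewrite -mulrnAl.
Qed.

End laplacian.

Theorem theorem4p1 (R : realType) (n : nat)
  (g : 'rV[R]_n.+1 -> R) (w : 'rV[R]_n.+1 -> R -> R)
  (g_ge0 : forall y, half_space y -> 0 <= g y)
  (g_meas : measurable_fun (half_space : set (leb_rV R n)) (g : leb_rV R n -> R))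
  (wE : forall (x : 'rV[R]_n.+1) (t : R), half_space x -> 0 < t ->
    (w x t)%:E = (\int[lebesgue_rV]_(y in (half_space : set (leb_rV R n)))
                    (dirichlet_heat_kernel x y t * g y)%:E)%E)
  (w_gt0 : forall (x : 'rV[R]_n.+1) (t : R), half_space x -> 0 < t -> 0 < w x t) :
  (forall (x : 'rV[R]_n.+1) (t : R), half_space x -> 0 < t ->
    has_laplacian (fun z => ln (w z t)) x /\
    laplacian (fun z => ln (w z t)) x
      >= - (n.+1%:R / (2 * t)) - 1 / x 0 ord_max ^+ 2) /\
  (forall (x : 'rV[R]_n.+1) (t : R), half_space x -> 0 < t ->
    has_laplacian (fun z => w z t) x /\
    laplacian (fun z => w z t) x / w x t
      - sqnorm (grad (fun z => w z t) x) / w x t ^+ 2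
      >= - (n.+1%:R / (2 * t)) - 1 / x 0 ord_max ^+ 2).
Proof.
have curv z t i z0 t0 := log_curvature_solution g_ge0 g_meas wE w_gt0 z t i z0 t0.
have line0 (z : 'rV[R]_n.+1) (i : 'I_n.+1) : z + (0 : R) *: delta_mx 0 i = z.
  by rewrite scale0r addr0.
have curv_ln z t i (z0 : half_space z) (t0 : 0 < t) :
    exists (h : R -> R) (h' : R),
    [/\ \forall s \near (0 : R), is_derive (s : R) (1 : R)
          (fun s => ln (w (z + s *: delta_mx 0 i) t)) (h s),
        is_derive (0 : R) (1 : R) h h' &
        - (1 / (2 * t) + (if i == ord_max then 1 / z 0 ord_max ^+ 2 else 0)) <= h'].
  by apply: log_curvature_ln (curv z t i z0 t0); rewrite line0 w_gt0.
split=> x t x0 t0; split.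
- apply: has_laplacian_half_space x0 => z i z0.
  by have [h [h' [? ? _]]] := curv_ln z t i z0 t0; exists h, h'.
- rewrite -sum_curvature_bounds; apply: ler_sum => i _.
  have [h [h' [dh dh' hk]]] := curv_ln x t i x0 t0.
  by have [_ _ _ ->] := partial_line (fun z => ln (w z t)) x i h h' dh dh'.
- apply: has_laplacian_half_space x0 => z i z0.
  by have [h [h' [? ? _]]] := curv z t i z0 t0; exists h, h'.
- rewrite -sum_curvature_bounds /laplacian /sqnorm !mulr_suml -sumrB.
  apply: ler_sum => i _; rewrite mxE.
  have [h [h' [dh dh' hk]]] := curv x t i x0 t0.
  have [_ -> _ ->] := partial_line (fun z => w z t) x i h h' dh dh'.
  by move: hk; rewrite line0 expr_div_n.
Qed.
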